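(* Let $2\leq p<\infty$ and $1\leq k\leq n_0=\min\{m,n\}$. Let $A\in\mathbb{M}_{m\times n}(\mathbb{C})$ with $A\ne0$, and let $\mathcal{M}$ be a subspace of $\mathbb{M}_{m\times n}(\mathbb{C})$. Let $m_1\in\mathbb{N}$, let $\alpha_1,\ldots,\alpha_{m_1}\geq0$ with $\sum_{j=1}^{m_1}\alpha_j=1$, and for each $1\le j\le m_1$ let $v_1^{(j)},\ldots,v_k^{(j)}\in\mathbb{C}^n$ be orthonormal vectors with $A^*Av_i^{(j)}=\sigma_i^2(A)v_i^{(j)}$ for all $1\le i\le k$. For $i=1,\ldots,k$ define the density matrix $T_i=\sum_{j=1}^{m_1}\alpha_j\,v_i^{(j)}{v_i^{(j)}}^*$. If $$\frac{1}{\|A\|_{(p,k)}^{p-1}}A(A^*A)^{\frac{p-2}{2}}\sum_{i=1}^{k}T_i\in\mathcal{M}^{\perp},$$ then $\|A\|_{(p,k)}\leq\|A+B\|_{(p,k)}$ for all $B\in\mathcal{M}$.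
   Context: $\mathbb{M}_{m\times n}(\mathbb{C})$ is the complex vector space of $m\times n$ complex matrices with inner product $\langle X,Y\rangle=\operatorname{tr}(Y^*X)$, and $\mathcal{M}^\perp$ is the orthogonal complement of the (complex linear) subspace $\mathcal{M}$ for this inner product. $n_0=\min\{m,n\}$ and $\sigma_1(A)\ge\cdots\ge\sigma_{n_0}(A)$ are the singular values of $A$. For $1\le p<\infty$ and $1\le k\le n_0$ the Ky Fan $p$-$k$ norm is $\|A\|_{(p,k)}=(\sigma_1^p(A)+\cdots+\sigma_k^p(A))^{1/p}$. A density matrix is a positive semidefinite matrix of trace $1$. For $p=2$, $(A^*A)^{0}$ is the identity matrix. *)

(* Defs.v *)
From HB Require Import structures.
From mathcomp Require Import all_boot all_order all_algebra.
From mathcomp Require Import complex.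
From mathcomp Require Import reals exp.

Set Implicit Arguments.
Unset Strict Implicit.
Unset Printing Implicit Defensive.

Import Order.TTheory GRing.Theory Num.Theory.

Local Open Scope ring_scope.
Local Open Scope sesquilinear_scope.
Local Open Scope complex_scope.

Section InnerProduct.
Variables (C : numClosedFieldType) (m n : nat).

(* For n = 1 this is the standard inner product of C^m. *)
Definition mxinner (X Y : 'M[C]_(m, n)) : C := \tr (Y^t* *m X).

Let mxinner_is_bilinear :
  bilinear_for
    (GRing.Scale.Law.clone _ _ ( *%R ) _)
    (GRing.Scale.Law.clone _ _ (Num.conj \; *%R) _)
    mxinner.
Proof.
split=> [Y | X] a U V /=; rewrite /mxinner.
  by rewrite mulmxDr -scalemxAr linearP.
by rewrite linearP /= map_mxD map_mxZ mulmxDl -scalemxAl linearP.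
Qed.

HB.instance Definition _ :=
  bilinear_isBilinear.Build C _ _ _
    (GRing.Scale.Law.clone _ _ ( *%R ) _)
    (GRing.Scale.Law.clone _ _ (Num.conj \; *%R) _)
    mxinner mxinner_is_bilinear.

Let mxinner_is_hermitian X Y :
  mxinner X Y = (-1) ^+ false * Num.conj (mxinner Y X).
Proof.
rewrite mul1r /mxinner -mxtrace_tr -trace_map_mx trmx_mul map_mxM.
by rewrite -map_mx_comp (map_mx_id (@conjCK _)) map_trmx trmxK.
Qed.

HB.instance Definition _ :=
  isHermitianSesquilinear.Build C _ false (@Num.conj C) mxinner
    mxinner_is_hermitian.

End InnerProduct.

Section Matrices.
Variable R : realType.
Local Notation C := R[i].

(* [spectral_diag (A^t* *m A)] lists the n eigenvalues of A^* A with
   multiplicity; they are real and at most min(m, n) of them are nonzero. *)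
Definition singvals m n (A : 'M[C]_(m, n)) : seq R :=
  take (minn m n)
    (sort >=%R
       [seq Num.sqrt (complex.Re (spectral_diag (A^t* *m A) 0 i)) | i : 'I_n]).

(* Indices start at 0: [singval A i] is the (i+1)-st largest singular value. *)
Definition singval m n (A : 'M[C]_(m, n)) (i : nat) : R := (singvals A)`_i.

Definition kyfan m n (p : R) (k : nat) (A : 'M[C]_(m, n)) : R :=
  (\sum_(i < k) singval A i `^ p) `^ p^-1.

(* Real powers of a positive semidefinite matrix H, by functional calculus on
   H = P^-1 D P. Since 0 `^ 0 = 1, [psdpow H 0] is the identity. *)
Definition psdpow n (H : 'M[C]_n) (s : R) : 'M[C]_n :=
  invmx (spectralmx H)
  *m diag_mx (map_mx (fun z : C => (complex.Re z `^ s)%:C) (spectral_diag H))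
  *m spectralmx H.

Definition density n (T : 'M[C]_n) : Prop :=
  [/\ T^t* = T, (forall x : 'cV[C]_n, 0 <= \tr (x^t* *m T *m x)) & \tr T = 1].

Definition mixture n m1 (alpha : 'I_m1 -> R) (v : 'I_m1 -> 'cV[C]_n) : 'M[C]_n :=
  \sum_(j < m1) (alpha j)%:C *: (v j *m (v j)^t*).

Lemma density_mixture n m1 (alpha : 'I_m1 -> R) (v : 'I_m1 -> 'cV[C]_n) :
  (forall j, 0 <= alpha j) -> \sum_(j < m1) alpha j = 1 ->
  (forall j, mxinner (v j) (v j) = 1) -> density (mixture alpha v).
Proof.
have mulCt p q r (X : 'M[C]_(p, q)) (Y : 'M[C]_(q, r)) :
    (X *m Y)^t* = Y^t* *m X^t* by rewrite trmx_mul map_mxM.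
move=> alpha_ge0 sum_alpha v1; split.
- rewrite /mixture linear_sum /= raddf_sum; apply: eq_bigr => j _.
  rewrite linearZ /= map_mxZ mulCt trmxCK; congr (_ *: _).
  by apply/CrealP; rewrite complex_real.
- move=> x; rewrite /mixture mulmx_sumr mulmx_suml linear_sum /=.
  apply: sumr_ge0 => j _; rewrite -scalemxAr -scalemxAl linearZ /=.
  rewrite mulr_ge0 ?ler0c ?alpha_ge0 // mulmxA -(mulmxA (_ *m v j)).
  have -> : x^t* *m v j = ((v j)^t* *m x)^t* by rewrite mulCt trmxCK.
  by rewrite trace_mx11 !mxE big_ord1 !mxE mulrC mul_conjC_ge0.
- rewrite /mixture linear_sum /=.
  transitivity (\sum_(j < m1) (alpha j)%:C).
    apply: eq_bigr => j _; rewrite linearZ /= mxtrace_mulC.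
    by rewrite -/(mxinner (v j) (v j)) v1 mulr1.
  by rewrite -(rmorph_sum (real_complex R)) sum_alpha.
Qed.

End Matrices.

(* Main.v *)
(* Put X = A + B, s = p / 2, b_i = sigma_i(A)^2 and L = ||X||_(p,k)^p. Pairing
   A (A^* A)^(s-1) sum_i T_i with A gives ||A||_(p,k)^p, and by orthogonality so
   does pairing it with X; that is,
     ||A||_(p,k)^p = sum_j alpha_j sum_i b_i^(s-1) Re <X v_i^(j), A v_i^(j)>.
   Since 2 Re <X v, A v> <= |X v|^2 + |A v|^2, it is enough to bound, for each
   orthonormal family v_1, ..., v_k,
     s sum_i b_i^(s-1) |X v_i|^2 <= (s-1) sum_i b_i^s + L.
   Expand |X v_i|^2 = sum_l lambda_l |<u_l, v_i>|^2 in an orthonormal eigenbasis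
   u of X^* X and apply Young's inequality s a^(s-1) t <= (s-1) a^s + t^s with
   a = b_i, t = lambda_l. What remains is sum_l w_l lambda_l^s, where
   w_l = sum_i |<u_l, v_i>|^2 lies in [0, 1] (Bessel) and sum_l w_l = k, so it
   is at most the sum of the k largest lambda_l^s, which is L. *)
Require Import Defs.
From mathcomp Require Import all_boot all_order all_algebra.
From mathcomp Require Import complex.
From mathcomp Require Import reals exp.
From mathcomp Require Import ring lra.

Import Order.TTheory GRing.Theory Num.Theory.

Local Open Scope ring_scope.
Local Open Scope sesquilinear_scope.
Local Open Scope complex_scope.

(** * Scalar, weighted-sum and Bessel inequalities *)

Lemma young_powR (R : realType) (s a t : R) : 1 <= s -> 0 <= a -> 0 <= t ->
  s * (a `^ (s - 1) * t) <= (s - 1) * a `^ s + t `^ s.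
Proof.
(* For s = 1 the conjugate exponent s / (s - 1) would be infinite, so this case is computed
   directly. *)
rewrite le_eqVlt => /predU1P[<- a0 t0|s1 a0 t0].
  by rewrite subrr powRr0 mul1r mul0r add0r mul1r powRr1.
have s0 : 0 < s by lra.
have d0 : 0 < s - 1 by lra.
have q0 : 0 < s / (s - 1) by rewrite divr_gt0.
have := conjugate_powR (powR_ge0 a (s - 1)) t0 q0 s0.
rewrite -powRrM (mulrC (s - 1)) divfK ?gt_eqF// => /(_ _)H.
have {H} : a `^ (s - 1) * t <= a `^ s / (s / (s - 1)) + t `^ s / s.
  by apply: H; field; rewrite !gt_eqF.
rewrite -(ler_pM2l s0) => /le_trans; apply.
by rewrite le_eqVlt; apply/orP; left; apply/eqP; field; rewrite !gt_eqF.
Qed.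

(** Weights in [0, 1] of total k do best on the k largest entries. Subtracting the threshold c, the
    value of g at the k-th largest entry, lowers both sides by k c. *)
Lemma sum_weighted_le_top (R : realDomainType) (n k : nat) (g : R -> R)
    (x w : 'I_n -> R) :
  {in Num.nneg &, {homo g : a b / a <= b}} -> (forall i, 0 <= x i) ->
  (0 < k <= n)%N -> (forall i, 0 <= w i <= 1) -> \sum_i w i = k%:R ->
  \sum_i w i * g (x i) <=
    \sum_(i < k) g (sort >=%R [seq x i | i : 'I_n])`_i.
Proof.
move=> g_homo x0 /andP[k0 kn] w01 wk.
set s := sort _ _; set c := g s`_k.-1.
have k1n : (k.-1 < n)%N by rewrite prednK.
have ss : size s = n by rewrite size_sort size_map size_enum_ord.
have ps : perm_eq s [seq x i | i : 'I_n] by rewrite perm_sort.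
have s_nneg i : (i < n)%N -> s`_i \is Num.nneg.
  move=> ltin; have : s`_i \in s by rewrite mem_nth ?ss.
  by rewrite (perm_mem ps) => /mapP[j _ ->]; rewrite nnegrE.
have s_sorted i j : (i <= j < n)%N -> s`_j <= s`_i.
  case/andP=> ij jn; have sorted_s : sorted >=%R s.
    by apply: sort_sorted => a b; apply: le_total.
  have ge_tr : transitive (>=%R : rel R) by move=> a b d ba /le_trans; apply.
  have := sorted_leq_nth ge_tr (@lexx _ R) 0 sorted_s.
  apply; rewrite ?inE ?ss //.
  exact: leq_ltn_trans jn.
have -> : \sum_i w i * g (x i) = k%:R * c + \sum_i w i * (g (x i) - c).
  by rewrite -wk mulr_suml -big_split; apply: eq_bigr => i _ /=; ring.
(* For 0 <= w <= 1, w * (g y - c) is at most the positive part h y, which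
   vanishes past the k largest values. *)
pose h y := Num.max 0 (g y - c).
have le_h : \sum_i w i * (g (x i) - c) <= \sum_i h (x i).
  apply: ler_sum => i _; have /andP[wi0 wi1] := w01 i.
  rewrite /h; case: (lerP 0 (g (x i) - c)) => [d0|/ltW d0].
    by rewrite ler_piMl.
  by rewrite mulr_ge0_le0.
have -> : \sum_(i < k) g s`_i = k%:R * c + \sum_(i < k) (g s`_i - c).
  by rewrite big_split /= sumrN sumr_const card_ord mulr_natl; ring.
rewrite lerD2l (le_trans le_h)//.
have -> : \sum_i h (x i) = \sum_(i < n) h s`_i.
  transitivity (\sum_(y <- s) h y); last by rewrite (big_nth 0) ss big_mkord.
  by rewrite (perm_big _ ps) big_image.
rewrite (big_ord_widen n (fun i => g s`_i - c)) // [leRHS]big_mkcond /=.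
apply: ler_sum => i _; rewrite /h ge_max.
case: ltnP => [ik|ki].
  rewrite lexx andbT subr_ge0; apply: g_homo.
  - by rewrite s_nneg.
  - exact: s_nneg.
  - by apply: s_sorted; rewrite k1n -ltnS prednK ?ik.
rewrite lexx /= subr_le0; apply: g_homo; first exact: s_nneg.
  by rewrite s_nneg.
by rewrite s_sorted // ltn_ord (leq_trans (leq_pred _) ki) /=.
Qed.

(** The rows of U are orthonormal, so Q = U^* U is a Hermitian projection; its diagonal entry q
    satisfies q^2 <= sum_i |Q_li|^2 = q. *)
Lemma unitarymx_col_le1 (C : numClosedFieldType) k n (U : 'M[C]_(k, n)) l :
  U \is unitarymx -> \sum_i `|U i l| ^+ 2 <= 1.
Proof.
move=> /unitarymxP UU; set q := \sum_i _.
pose Q := U^t* *m U.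
have qE : q = Q l l.
  by rewrite mxE; apply: eq_bigr => i _; rewrite normCK !mxE mulrC.
have Qh : Q^t* = Q by rewrite /Q trmx_mul map_mxM trmxCK.
have QQ : Q *m Q^t* = Q.
  by rewrite Qh /Q mulmxA -(mulmxA _ U) UU mulmx1.
have q0 : 0 <= q by apply: sumr_ge0 => i _; rewrite exprn_ge0.
have : q ^+ 2 <= q.
  rewrite -{1}(ger0_norm q0) [leRHS]qE -[in leRHS]QQ mxE (bigD1 l) //=.
  rewrite {1}qE normCK !mxE lerDl; apply: sumr_ge0 => i _.
  by rewrite !mxE -normCK exprn_ge0.
have [->|qN0] := eqVneq q 0; first by rewrite ler01.
by rewrite expr2 ger_pMl // lt_def qN0.
Qed.

Lemma mxinner_ge0 (C : numClosedFieldType) m n (X : 'M[C]_(m, n)) :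
  0 <= mxinner X X.
Proof.
apply: sumr_ge0 => i _; rewrite mxE; apply: sumr_ge0 => j _.
by rewrite !mxE mulrC -normCK exprn_ge0.
Qed.

Lemma mxinner_col (C : numClosedFieldType) n (x : 'cV[C]_n) :
  mxinner x x = \sum_l `|x l 0| ^+ 2.
Proof.
rewrite /mxinner trace_mx11 mxE; apply: eq_bigr => l _.
by rewrite !mxE mulrC -normCK.
Qed.

(** * Eigenvalues and powers of the Gram matrix X^* X *)

Section Gram.
Variables (R : realType) (m n : nat).
Local Notation C := R[i].
Implicit Types (X : 'M[C]_(m, n)) (v : 'cV[C]_n).

Lemma gram_spectral X :
  X^t* *m X = (spectralmx (X^t* *m X))^t*
    *m diag_mx (spectral_diag (X^t* *m X)) *m spectralmx (X^t* *m X).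
Proof.
rewrite -invmx_unitary ?spectral_unitarymx //.
apply/orthomx_spectralP/normalmxP.
by rewrite trmx_mul map_mxM trmxCK.
Qed.

(** Left unsorted and untruncated, so that l also indexes the eigenvector in row l of
    [spectralmx]. *)
Definition gram_singval X (l : 'I_n) : R :=
  Num.sqrt (complex.Re (spectral_diag (X^t* *m X) 0 l)).

(** Each eigenvalue is the squared norm of X applied to an eigenvector, hence real and nonnegative:
    [complex.Re] and [Num.sqrt] lose nothing. *)
Lemma gram_singvalE X l :
  spectral_diag (X^t* *m X) 0 l = (gram_singval X l ^+ 2)%:C.
Proof.
have d0 : 0 <= spectral_diag (X^t* *m X) 0 l.
  set P := spectralmx (X^t* *m X); set D := spectral_diag _.
  have PP : P *m P^t* = 1%:M by apply/unitarymxP/spectral_unitarymx.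
  have : P *m (X^t* *m X) *m P^t* = diag_mx D.
    by rewrite gram_spectral -/P -/D !mulmxA PP mul1mx -mulmxA PP mulmx1.
  move/matrixP/(_ l l); rewrite [in RHS]mxE eqxx mulr1n => <-.
  have -> : P *m (X^t* *m X) *m P^t* = (X *m P^t*)^t* *m (X *m P^t*).
    by rewrite trmx_mul map_mxM trmxCK !mulmxA.
  rewrite mxE; apply: sumr_ge0 => i _.
  by rewrite !mxE mulrC -normCK exprn_ge0.
rewrite /gram_singval sqr_sqrtr; first by rewrite RRe_real ?ger0_real.
by rewrite -ler0c RRe_real ?ger0_real.
Qed.

Lemma mxinner_gram X v : mxinner (X *m v) (X *m v) =
  \sum_l (gram_singval X l ^+ 2)%:C * `|(spectralmx (X^t* *m X) *m v) l 0| ^+ 2.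
Proof.
set P := spectralmx _.
have -> : mxinner (X *m v) (X *m v) =
    \tr ((P *m v)^t* *m diag_mx (spectral_diag (X^t* *m X)) *m (P *m v)).
  rewrite /mxinner !trmx_mul !map_mxM !mulmxA -(mulmxA _ _ X).
  by rewrite [in LHS]gram_spectral !mulmxA.
rewrite trace_mx11 mxE; apply: eq_bigr => l _.
by rewrite mul_mx_diag !mxE gram_singvalE normCK; ring.
Qed.

(** Each coordinate of v in the eigenbasis either vanishes or belongs to an eigenvalue equal to
    mu. *)
Lemma psdpow_eigen X v (mu s : R) : X^t* *m X *m v = mu%:C *: v ->
  psdpow (X^t* *m X) s *m v = (mu `^ s)%:C *: v.
Proof.
rewrite {1}gram_spectral /psdpow invmx_unitary ?spectral_unitarymx //.
set P := spectralmx _; set D := spectral_diag _.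
have PP : P *m P^t* = 1%:M by apply/unitarymxP/spectral_unitarymx.
have PP' : P^t* *m P = 1%:M.
  exact: mulmx1C.
move=> /(congr1 (mulmx P)); rewrite !mulmxA PP mul1mx -!mulmxA -scalemxAr => E.
rewrite [in RHS](_ : v = P^t* *m (P *m v)); last by rewrite mulmxA PP' mul1mx.
rewrite scalemxAr; congr (_ *m _); apply/matrixP => l j.
move/matrixP/(_ l j): E; rewrite !mul_diag_mx !mxE.
set z := \sum_i _; have [->|z0 /(mulIf z0) ->//] := eqVneq z 0.
by rewrite !mulr0.
Qed.

(** * Ky Fan norms and orthonormal families *)

Lemma kyfan_powE k (p : R) X : (k <= minn m n)%N -> 0 < p ->
  kyfan p k X `^ p =
  \sum_(i < k) (sort >=%R [seq gram_singval X l | l : 'I_n])`_i `^ p.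
Proof.
move=> km p0; rewrite /kyfan -powRrM mulVf ?gt_eqF // powRr1; last first.
  by apply: sumr_ge0 => i _; apply: powR_ge0.
by apply: eq_bigr => i _; rewrite /singval nth_take // (leq_trans (ltn_ord i)).
Qed.

Lemma kyfan_le_powR k (p : R) X (Y : 'M[C]_(m, n)) :
  0 < p -> kyfan p k X `^ p <= kyfan p k Y `^ p -> kyfan p k X <= kyfan p k Y.
Proof.
have kyfan_ge0 Z : 0 <= kyfan p k Z by rewrite /kyfan powR_ge0.
move=> p0; apply: contraTT; rewrite -!ltNge.
by apply: gt0_ltr_powR; rewrite ?nnegrE.
Qed.

Lemma singval_ge0 X i : 0 <= singval X i.
Proof.
rewrite /singval; have [li|/(nth_default 0)->//] := ltnP i (size (singvals X)).
move: (mem_nth 0 li) => /mem_take; rewrite mem_sort => /mapP[l _ ->].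
exact: sqrtr_ge0.
Qed.

Lemma kyfan_young k (s : R) X (a : 'I_k -> R) (v : 'I_k -> 'cV[C]_n) :
  1 <= s -> (0 < k <= minn m n)%N -> (forall i, 0 <= a i) ->
  (forall i i', mxinner (v i) (v i') = (i == i')%:R) ->
  s * (\sum_i a i `^ (s - 1) * complex.Re (mxinner (X *m v i) (X *m v i))) <=
    (s - 1) * \sum_i a i `^ s + kyfan (s * 2) k X `^ (s * 2).
Proof.
rewrite !mulr_sumr => s1 /andP[k0 km] a0 v_on.
set P := spectralmx (X^t* *m X).
(* W is the matrix of weights |<u_l, v_i>|^2: its rows sum to 1 (Parseval), its columns to at most 1
   (Bessel). *)
pose W i l : R := complex.Re (`|(P *m v i) l 0| ^+ 2).
have W0 i l : 0 <= W i l.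
  by rewrite -ler0c RRe_real ?exprn_ge0 // ger0_real // exprn_ge0.
have WE i l : (W i l)%:C = `|(P *m v i) l 0| ^+ 2.
  by rewrite RRe_real // ger0_real // exprn_ge0.
have PP : P^t* *m P = 1%:M.
  by apply: mulmx1C; apply/unitarymxP/spectral_unitarymx.
have Pv i j : mxinner (P *m v i) (P *m v j) = mxinner (v i) (v j).
  by rewrite /mxinner trmx_mul map_mxM mulmxA -(mulmxA _ _ P) PP mulmx1.
have W1 i : \sum_l W i l = 1.
  apply: complexI; rewrite rmorph_sum /=.
  under eq_bigr do rewrite WE.
  by rewrite -mxinner_col Pv v_on eqxx.
have Wle1 l : \sum_i W i l <= 1.
  rewrite -lecR rmorph_sum /=; under eq_bigr do rewrite WE.
  pose U : 'M[C]_(k, n) := \matrix_(i, l) Num.conj ((P *m v i) l 0).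
  have : U \is unitarymx.
    apply/unitarymxP/matrixP => i j.
    rewrite mxE [RHS]mxE eq_sym -v_on -Pv /mxinner trace_mx11 mxE.
    by apply: eq_bigr => l' _; rewrite !mxE conjCK.
  move/(@unitarymx_col_le1 _ _ _ _ l); congr (_ <= _).
  by apply: eq_bigr => i _; rewrite mxE norm_conjC.
have NE i : complex.Re (mxinner (X *m v i) (X *m v i)) =
    \sum_l gram_singval X l ^+ 2 * W i l.
  apply: complexI; rewrite RRe_real ?ger0_real ?mxinner_ge0 // mxinner_gram.
  rewrite rmorph_sum; apply: eq_bigr => l _ /=.
  by rewrite -/P -WE -rmorphM.
have Y i l : s * (a i `^ (s - 1) * gram_singval X l ^+ 2) <=
    (s - 1) * a i `^ s + gram_singval X l `^ (s * 2).
  rewrite mulrC [in leRHS]mulrC mulrC (mulrC (a i `^ s)).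
  rewrite [X in _ + _ `^ X]mulrC powRrM powR_mulrn ?sqrtr_ge0 //.
  by apply: young_powR; rewrite ?a0 ?sqr_ge0.
have s0 : 0 < s * 2 by lra.
rewrite kyfan_powE //.
apply: (@le_trans _ _ (\sum_i (s - 1) * a i `^ s +
    \sum_l (\sum_i W i l) * gram_singval X l `^ (s * 2))); last first.
  rewrite lerD2l; apply: (@sum_weighted_le_top _ _ _ (fun z => z `^ (s * 2))).
  - by apply: ge0_ler_powR; apply: ltW.
  - by move=> l; apply: sqrtr_ge0.
  - by rewrite k0 (leq_trans km) // geq_minr.
  - by move=> l; rewrite Wle1 sumr_ge0.
  - by rewrite exchange_big /= (eq_bigr _ (fun i _ => W1 i)) sumr_const
      card_ord.
under [X in _ <= _ + X]eq_bigr do rewrite mulr_suml.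
rewrite [X in _ <= _ + X]exchange_big -big_split /=.
apply: ler_sum => i _.
(* The row sum 1 = sum_l W i l spreads the term in a_i over all l, which reduces the claim to the
   Young bound for each pair. *)
rewrite NE -[X in _ <= X + _]mulr1 -[X in _ <= _ * X + _](W1 i).
rewrite !mulr_sumr -big_split /=; apply: ler_sum => l _.
rewrite (mulrC (W i l)) -mulrDl [X in s * X]mulrA [leLHS]mulrA.
exact: ler_wpM2r.
Qed.

End Gram.

(** * Real parts of inner products *)

Lemma Re_sum (R : realType) (I : finType) (F : I -> R[i]) :
  complex.Re (\sum_i F i) = \sum_i complex.Re (F i).
Proof. by apply: big_morph => // -[a b] [c d]. Qed.

Lemma Re_scale (R : realType) (c : R) (z : R[i]) :
  complex.Re (c%:C * z) = c * complex.Re z.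
Proof. by case: z => a b /=; rewrite mul0r subr0. Qed.

Lemma Re_mxinner_le (R : realType) m n (X Y : 'M[R[i]]_(m, n)) :
  2 * complex.Re (mxinner X Y) <=
    complex.Re (mxinner X X) + complex.Re (mxinner Y Y).
Proof.
have := mxinner_ge0 _ _ _ (X - Y).
have YX : mxinner Y X = Num.conj (mxinner X Y).
  by rewrite [LHS](hermC (@mxinner R[i] m n)) expr0 mul1r.
rewrite linearBl /= !linearBr /= YX.
case: (mxinner X X) (mxinner X Y) (mxinner Y Y) => [a b] [c d] [e f].
by rewrite lecE /= => /andP[_]; lra.
Qed.

(** On the eigenvectors the power of A^* A is the real scalar b_i^s, and cyclicity of the trace
    turns the pairing with A v v^* into <Y v, A v>. *)
Lemma Re_mxinner_mixture (R : realType) m n k m1 (s : R) (A Y : 'M[R[i]]_(m, n))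
    (alpha : 'I_m1 -> R) (v : 'I_m1 -> 'I_k -> 'cV[R[i]]_n) (b : 'I_k -> R) :
  (forall j i, A^t* *m A *m v j i = (b i)%:C *: v j i) ->
  complex.Re (mxinner Y
    (A *m psdpow (A^t* *m A) s *m \sum_i mixture alpha (fun j => v j i))) =
  \sum_j alpha j *
    \sum_i b i `^ s * complex.Re (mxinner (Y *m v j i) (A *m v j i)).
Proof.
have conjR (c : R) : Num.conj c%:C = c%:C := conjc_real c.
move=> Av; under [RHS]eq_bigr do rewrite mulr_sumr.
rewrite [RHS]exchange_big mulmx_sumr linear_sumr Re_sum /=.
apply: eq_bigr => i _.
rewrite /mixture mulmx_sumr linear_sumr Re_sum /=; apply: eq_bigr => j _.
rewrite -scalemxAr linearZr /= mulmxA -(mulmxA A).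
rewrite (psdpow_eigen _ _ _ _ _ _ _ (Av j i)) -scalemxAr -scalemxAl linearZr /=.
rewrite !(conjR _) !Re_scale.
congr (_ * (_ * complex.Re _)).
rewrite /mxinner !trmx_mul !map_mxM trmxCK /= -!mulmxA mxtrace_mulC.
by rewrite !mulmxA.
Qed.

(** * Minimality of the norm at A from the orthogonality condition *)

Theorem theorem2p16 (R : realType) (m n k : nat) (p : R)
    (A : 'M[R[i]]_(m, n)) (M : {vspace 'M[R[i]]_(m, n)})
    (m1 : nat) (alpha : 'I_m1 -> R) (v : 'I_m1 -> 'I_k -> 'cV[R[i]]_n) :
  2 <= p -> (1 <= k)%N -> (k <= minn m n)%N -> A != 0 ->
  (forall j, 0 <= alpha j) -> \sum_(j < m1) alpha j = 1 ->
  (forall j i i', mxinner (v j i) (v j i') = (i == i')%:R) ->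
  (forall j i, A^t* *m A *m v j i = (singval A i ^+ 2)%:C *: v j i) ->
  let T := fun i : 'I_k => mixture alpha (fun j => v j i) in
  (kyfan p k A `^ (p - 1))^-1%:C
    *: (A *m psdpow (A^t* *m A) ((p - 2) / 2) *m \sum_(i < k) T i)
    \in orthov (@mxinner R[i] m n) M ->
  forall B : 'M[R[i]]_(m, n), B \in M -> kyfan p k A <= kyfan p k (A + B).
Proof.
move=> p2 k1 km _ alpha0 alpha1 v_on Av T /mem_orthovP GM B BM.
(* Once the norm is nonzero, the normalising factor is invertible and cancels from the orthogonality
   condition. *)
have [->|kA0] := eqVneq (kyfan p k A) 0; first by rewrite /kyfan powR_ge0.
set s := p / 2; have ps : p = s * 2 by rewrite divfK ?pnatr_eq0.
have s1 : 1 <= s by rewrite /s; lra.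
have p0 : 0 < p by lra.
have sB1 : (p - 2) / 2 = s - 1 by rewrite /s; field.
pose b (i : 'I_k) := singval A i ^+ 2.
have b0 i : 0 <= b i by apply: sqr_ge0.
set G := A *m _ *m _ in GM.
have BG : mxinner B G = 0.
  apply/eqP; rewrite (herm_eq0C (@mxinner R[i] m n)).
  have /eqP := GM B BM; rewrite linearZl_LR /= mulf_eq0 => /orP[|//].
  rewrite -(rmorph0 (real_complex R)) (inj_eq (@complexI R)) invr_eq0.
  by rewrite powR_eq0 (negbTE kA0).
have KE : kyfan p k A `^ p = \sum_i b i `^ s.
  rewrite /kyfan -powRrM mulVf ?gt_eqF // powRr1; last first.
    by apply: sumr_ge0 => i _; apply: powR_ge0.
  apply: eq_bigr => i _.
  by rewrite ps mulrC powRrM powR_mulrn // singval_ge0.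
have bs i : b i `^ (s - 1) * b i = b i `^ s.
  by rewrite mulrC mulr_powRB1 //; lra.
have AA j i : complex.Re (mxinner (A *m v j i) (A *m v j i)) = b i.
  rewrite /mxinner trmx_mul map_mxM mulmxA -(mulmxA _ _ A) -mulmxA Av.
  by rewrite -scalemxAr linearZ /= -/(mxinner _ _) v_on eqxx mulr1.
have : complex.Re (mxinner (A + B) G) = complex.Re (mxinner A G).
  by rewrite linearDl /= BG addr0.
rewrite /G /T sB1 !(Re_mxinner_mixture _ _ _ _ _ _ _ _ _ _ _ Av).
set S := (X in X = _); have -> : \sum_j alpha j * \sum_i b i `^ (s - 1) *
    complex.Re (mxinner (A *m v j i) (A *m v j i)) = kyfan p k A `^ p.
  rewrite -[RHS]mul1r -[X in _ = X * _]alpha1 mulr_suml KE.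
  apply: eq_bigr => j _.
  by congr (_ * _); apply: eq_bigr => i _; rewrite AA bs.
set K := kyfan p k A `^ p; set L := kyfan p k (A + B) `^ p => SK.
(* As S = K, this yields K <= L. The alpha_j sum to 1, so it suffices to prove it for each family
   j. *)
have SL : p * S <= (p - 1) * K + L.
  rewrite -[leRHS]mul1r -[X in _ <= X * _]alpha1 mulr_suml mulr_sumr.
  apply: ler_sum => j _.
  rewrite mulrCA ler_wpM2l //.
  pose N := \sum_i b i `^ (s - 1) *
    complex.Re (mxinner ((A + B) *m v j i) ((A + B) *m v j i)).
  have young : s * N <= (s - 1) * K + L.
    by rewrite /K KE /L ps; apply: kyfan_young; rewrite ?k1.
  have : 2 * \sum_i b i `^ (s - 1) *
      complex.Re (mxinner ((A + B) *m v j i) (A *m v j i)) <= N + K.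
    rewrite /K KE mulr_sumr -big_split /=; apply: ler_sum => i _.
    rewrite mulrCA -bs -mulrDr ler_wpM2l ?powR_ge0 //.
    by rewrite -[X in _ <= _ + X](AA j i) Re_mxinner_le.
  have s0 : 0 <= s by lra.
  move=> /(ler_wpM2l s0); set Z := \sum_i _ => ZN.
  (* With p = 2 s: p Z <= s N + s K <= (s - 1) K + L + s K = (p - 1) K + L. *)
  rewrite ps; move: young ZN; clearbody N Z K L; rewrite !mulrDr; lra.
have KL : K <= L by move: SL; rewrite SK; lra.
exact: kyfan_le_powR p0 KL.
Qed.
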